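(* For all integers $n\ge 1$, $r\ge 2$, $s\ge 1$, $\chi_{la}\big(r((2s)P_2\vee O_{2n+1})\big)=3$.
   Context: For a graph $G$ with $q$ edges, a local antimagic labeling is a bijection $f:E(G)\to\{1,\dots,q\}$ such that, writing $f^+(u)=\sum_{e\ni u}f(e)$, we have $f^+(u)\ne f^+(v)$ for every edge $uv$. $\chi_{la}(G)$ is the minimum over all local antimagic labelings of the number of distinct values of $f^+$. $aP_2$ is the disjoint union of $a$ one-edge paths, $O_m$ the edgeless graph on $m$ vertices, $\vee$ the join, $rH$ the disjoint union of $r$ copies of $H$. *)

(* Defs.v *)
From mathcomp Require Import all_boot.

Set Implicit Arguments.
Unset Strict Implicit.
Unset Printing Implicit Defensive.

Record sgraph := SGraph {
  vertex :> finType;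
  adj : rel vertex;
  adj_sym : symmetric adj;
  adj_irrefl : irreflexive adj }.

(* An edge is an unordered pair, encoded as the set of its two endpoints. *)
Definition edges (G : sgraph) : {set {set G}} :=
  [set [set p.1; p.2] | p : G * G & adj p.1 p.2].

Section PathGraph.
Variable n : nat.
Definition path_adj (i j : 'I_n) : bool :=
  (i.+1 == j :> nat) || (j.+1 == i :> nat).
Fact path_adj_sym : symmetric path_adj.
Proof. by move=> i j; rewrite /path_adj orbC. Qed.
Fact path_adj_irrefl : irreflexive path_adj.
Proof. by move=> i; rewrite /path_adj orbb eqn_leq ltnn. Qed.
Definition path_graph : sgraph := SGraph path_adj_sym path_adj_irrefl.
End PathGraph.

Section Edgeless.
Variable n : nat.
Definition edgeless_adj : rel 'I_n := fun _ _ => false.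
Fact edgeless_adj_sym : symmetric edgeless_adj. Proof. by []. Qed.
Fact edgeless_adj_irrefl : irreflexive edgeless_adj. Proof. by []. Qed.
Definition edgeless : sgraph := SGraph edgeless_adj_sym edgeless_adj_irrefl.
End Edgeless.

Section Join.
Variables G H : sgraph.
Definition join_adj (u v : (G + H)%type) : bool :=
  match u, v with
  | inl x, inl y => adj x y
  | inr x, inr y => adj x y
  | _, _ => true
  end.
Fact join_adj_sym : symmetric join_adj.
Proof. by move=> [x|x] [y|y] //=; rewrite adj_sym. Qed.
Fact join_adj_irrefl : irreflexive join_adj.
Proof. by move=> [x|x] /=; rewrite adj_irrefl. Qed.
Definition join : sgraph := SGraph join_adj_sym join_adj_irrefl.
End Join.

Section Copies.
Variables (r : nat) (H : sgraph).
Definition copies_adj (u v : ('I_r * H)%type) : bool :=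
  (u.1 == v.1) && adj u.2 v.2.
Fact copies_adj_sym : symmetric copies_adj.
Proof. by move=> u v; rewrite /copies_adj eq_sym adj_sym. Qed.
Fact copies_adj_irrefl : irreflexive copies_adj.
Proof. by move=> u; rewrite /copies_adj adj_irrefl andbF. Qed.
(* Disjoint union of r copies of H; (i, x) is the vertex x of the i-th copy. *)
Definition copies : sgraph := SGraph copies_adj_sym copies_adj_irrefl.
End Copies.

Section LocalAntimagic.
Variable G : sgraph.
Implicit Type f : {set G} -> nat.

(* A labeling is a function on all sets of vertices; only its values on
   [edges G] matter. *)
Definition edge_bijection f : Prop :=
  [/\ {in edges G, forall e, 1 <= f e <= #|edges G|},
      {in edges G &, injective f}
    & forall k, 1 <= k <= #|edges G| -> exists2 e, e \in edges G & f e = k].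

(* The induced vertex label f^+. *)
Definition vlabel f (u : G) : nat := \sum_(e in edges G | u \in e) f e.

Definition local_antimagic f : Prop :=
  edge_bijection f /\ (forall u v : G, adj u v -> vlabel f u <> vlabel f v).

Definition num_colors f : nat := size (undup (codom (vlabel f))).

(* [chi_la_eq c] means chi_la(G) = c. It is a relation because chi_la(G) is
   undefined when G has no local antimagic labeling, e.g. for G = K_2. *)
Definition chi_la_eq (c : nat) : Prop :=
  (exists2 f, local_antimagic f & num_colors f = c) /\
  (forall f, local_antimagic f -> c <= num_colors f).
End LocalAntimagic.

Arguments chi_la_eq : clear implicits.

(* Main.v *)
(** In the copy [P_2 \/ O_m] carried by the [j]-th of the [N = 2 r s] paths, put
    the label [j + 1] on the path, and place every other edge in a row of [N]
    consecutive integers, at position [j] or [N - 1 - j] (see [row] and [lab]).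
    Each end of a path meets [n + 1] rows read forwards and [n + 1] rows read
    backwards, so its induced label does not depend on [j].  At a vertex of
    [O_m], the two edges coming from path [j] have sum [c + 2 j] or [c' - 2 j];
    numbering the paths in boustrophedon order (see [col]) makes the sum of [j]
    over each copy the same.  Three colours are needed because of triangles. *)

Require Import Defs.
From mathcomp Require Import all_boot.
From mathcomp Require Import zify.

Set Implicit Arguments.
Unset Strict Implicit.
Unset Printing Implicit Defensive.

(** * Edges, vertex labels and colour counts in an arbitrary graph *)

Section Graph.
Variable G : sgraph.
Implicit Types (f : {set G} -> nat) (w : G -> G -> nat) (x y z u v : G).

Lemma set2_inj (a b x y : G) :
  [set a; b] = [set x; y] -> (a = x /\ b = y) \/ (a = y /\ b = x).
Proof.
move=> E.
have := set21 a b; rewrite E => /set2P [] eq_a; subst a.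
  have := set22 x b; rewrite E => /set2P [] eq_b; subst b; last by left.
  by have := set22 x y; rewrite -E !inE orbb => /eqP <-; left.
have := set22 y b; rewrite E => /set2P [] eq_b; subst b; first by right.
by have := set21 x y; rewrite -E !inE orbb => /eqP <-; right.
Qed.

Lemma edgesP (e : {set G}) :
  reflect (exists x y, adj x y /\ e = [set x; y]) (e \in edges G).
Proof.
apply: (iffP imsetP) => [[[x y]]|[x [y [xy ->]]]].
  by rewrite inE => xy ->; exists x, y.
by exists (x, y); rewrite ?inE.
Qed.

(** The map [v] to [[set u; v]] is a bijection from the neighbours of [u] to the edges through
    [u]. *)
Lemma vlabelE f u : vlabel f u = \sum_(v | adj u v) f [set u; v].
Proof.
rewrite /vlabel -(big_imset (h := fun v => [set u; v]) (A := adj u) (fun e => f e)).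
  apply: eq_bigl => e; apply/andP/imsetP => [[/edgesP [x [y [xy ->]]]]|[v uv ->]].
    rewrite !inE => /orP [] /eqP ->; first by exists y.
    by exists x; rewrite 1?setUC // -topredE /= adj_sym.
  by split; [apply/edgesP; exists u, v | rewrite !inE eqxx].
move=> v v' _ _ /set2_inj [[//]|[-> ->]] //.
Qed.

(** The orientation of [e] is picked arbitrarily, so the value is determined by [w] only when [w] is
    symmetric on adjacent vertices. *)
Definition edge_fun w (e : {set G}) : nat :=
  if [pick p : G * G | adj p.1 p.2 && (e == [set p.1; p.2])] is Some p
  then w p.1 p.2 else 0.

Lemma edge_funE w x y :
  (forall x y, adj x y -> w x y = w y x) -> adj x y ->
  edge_fun w [set x; y] = w x y.
Proof.
move=> w_sym xy; rewrite /edge_fun; case: pickP => [[a b] /= /andP []|].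
  by move=> ab /eqP /set2_inj [[-> ->]|[-> ->]] //; rewrite w_sym // adj_sym.
by move=> /(_ (x, y)); rewrite xy eqxx.
Qed.

Lemma edge_bijection_param f (E : finType) (ed : E -> {set G}) :
  edges G = [set ed e | e : E] -> injective (f \o ed) ->
  (forall e, 1 <= f (ed e) <= #|E|) -> edge_bijection f.
Proof.
move=> edgesE f_inj f_range.
have card_edges : #|edges G| = #|E|.
  by rewrite edgesE card_imset // => e e' eq_ed; apply: f_inj; rewrite /= eq_ed.
have mem_ed e : ed e \in edges G by rewrite edgesE imset_f.
split; rewrite ?card_edges.
- by move=> e; rewrite edgesE => /imsetP [e' _ ->].
- move=> e e'; rewrite edgesE => /imsetP [a _ ->] /imsetP [b _ ->] ff.
  by congr ed; apply: f_inj.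
have lt_f e : (f (ed e)).-1 < #|E| by have := f_range e; lia.
(* Labels shifted down by 1 map [E] injectively into ['I_#|E|]; equal cardinalities make this map
   onto. *)
have g_inj : injective (fun e => Ordinal (lt_f e)).
  move=> a b [] ff; apply: f_inj => /=.
  by have := f_range a; have := f_range b; lia.
move=> k k_range; have lt_k : k.-1 < #|E| by lia.
have /codomP [e /(congr1 val) /= ke] : Ordinal lt_k \in codom (fun e => Ordinal (lt_f e)).
  by rewrite inj_card_onto ?card_ord.
by exists (ed e) => //; have := f_range e; lia.
Qed.

Lemma mem_num_colors f x : vlabel f x \in undup (codom (vlabel f)).
Proof. by rewrite mem_undup codom_f. Qed.

Lemma triangle_num_colors f x y z :
  local_antimagic f -> adj x y -> adj y z -> adj x z -> 3 <= num_colors f.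
Proof.
move=> [_ f_la] xy yz xz.
apply: (@uniq_leq_size _ [:: vlabel f x; vlabel f y; vlabel f z]).
  rewrite /= !inE negb_or !andbT.
  by apply/andP; split; [apply/andP; split|]; apply/eqP; apply: f_la.
by move=> c; rewrite !inE => /or3P [] /eqP ->; apply: mem_num_colors.
Qed.

Lemma num_colors_le f (s : seq nat) :
  (forall x, vlabel f x \in s) -> num_colors f <= size s.
Proof.
move=> f_s; apply: uniq_leq_size; first exact: undup_uniq.
by move=> c; rewrite mem_undup => /codomP [x ->].
Qed.

End Graph.

(** * Adjacency and neighbourhood sums in the building blocks *)

Lemma path2_adj_neq0 (a b : path_graph 2) :
  adj a b -> (b != ord0) = (a == ord0).
Proof. by case: a b => [[|[|a]] la] [[|[|b]] lb]. Qed.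

Lemma sum_adj_copies r (H : sgraph) (i : 'I_r) (x : H) (F : copies r H -> nat) :
  \sum_(v | adj ((i, x) : copies r H) v) F v = \sum_(y | adj x y) F (i, y).
Proof.
rewrite (eq_bigr (fun v : copies r H => F (v.1, v.2))); last by case.
rewrite -(pair_big (fun j => i == j) (adj x) (fun j y => F (j, y))) /=.
by rewrite (big_pred1 i) // => j; rewrite eq_sym.
Qed.

Lemma sum_adj_joinl (G H : sgraph) (x : G) (F : join G H -> nat) :
  \sum_(v | adj (inl x : join G H) v) F v =
  \sum_(y | adj x y) F (inl y) + \sum_y F (inr y).
Proof. by rewrite big_sumType. Qed.

Lemma sum_adj_joinr (G H : sgraph) (x : H) (F : join G H -> nat) :
  \sum_(v | adj (inr x : join G H) v) F v =
  \sum_y F (inl y) + \sum_(y | adj x y) F (inr y).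
Proof. by rewrite big_sumType. Qed.

(** * Arithmetic of columns, rows and label sums *)

(* Boustrophedon: the [q]-th paths of the [r] copies occupy the columns
   [q * r, ..., q * r + r - 1], read backwards when [q] is odd. *)
Definition col (r i q : nat) : nat := q * r + (if odd q then r.-1 - i else i).

Lemma ltn_col r k i q : i < r -> q < k -> col r i q < k * r.
Proof. by rewrite /col => ir qk; case: odd; nia. Qed.

Lemma col_inj r i i' q q' :
  i < r -> i' < r -> col r i q = col r i' q' -> i = i' /\ q = q'.
Proof.
rewrite /col => ir ir' eq_col.
have qq' : q = q' by move: eq_col; case: odd; case: odd; nia.
by move: eq_col; rewrite qq'; case: odd; lia.
Qed.

(** Columns [2 * s] and [2 * s + 1] of copy [i] have offsets [i] and [r.-1 - i], so [i] cancels in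
    each consecutive pair. *)
Lemma sum_col r s i : i < r ->
  \sum_(q < 2 * s) col r i q = s * (2 * s * r).-1.
Proof.
move=> ir; elim: s => [|s IHs]; first by rewrite big_ord0.
have -> : 2 * s.+1 = (2 * s).+2 by lia.
rewrite !big_ord_recr /= IHs /col /= mul2n odd_double /=.
by nia.
Qed.

(* Rows are numbered from 0; row 0 is left for the edges of the paths, the
   even rows [2, ..., 2m] go to one end of the paths ([b = false]) and the odd
   rows [1, ..., 2m - 1] to the other, where [m] is the odd order of [O_m]. *)
Definition row (m : nat) (b : bool) (p : nat) : nat :=
  if odd p (+) b then m - p else m + p.+1.

Definition pos (N p j : nat) : nat := if odd p then j else N.-1 - j.

Definition lab (N m : nat) (b : bool) (p j : nat) : nat :=
  (row m b p * N + pos N p j).+1.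

Lemma row_gt0 m b p : p < m -> 0 < row m b p.
Proof. by rewrite /row; case: ifP; lia. Qed.

Lemma row_le m b p : p < m -> row m b p <= 2 * m.
Proof. by rewrite /row; case: ifP; lia. Qed.

(** As [m] is odd, the parity of the row is [b]. For fixed [b], the rows [m - p] are at most [m] and
    the rows [m + p.+1] exceed it, so the row also determines [p]. *)
Lemma row_inj m b b' p p' : odd m -> p < m -> p' < m ->
  row m b p = row m b' p' -> b = b' /\ p = p'.
Proof.
rewrite /row => om pm pm'.
case: b b' => [] []; case: ifP => hp; case: ifP => hp' /= eq_row; split; lia.
Qed.

Lemma ltn_pos N p j : j < N -> pos N p j < N.
Proof. by rewrite /pos; case: ifP; lia. Qed.

Lemma pos_inj N p j j' : j < N -> j' < N -> pos N p j = pos N p j' -> j = j'.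
Proof. by rewrite /pos; case: ifP; lia. Qed.

Lemma divmod_inj N a a' x x' :
  x < N -> x' < N -> a * N + x = a' * N + x' -> a = a' /\ x = x'.
Proof. by move=> xN xN' eq_ax; case: (ltngtP a a') eq_ax => [aa|aa|->]; nia. Qed.

(** Here [m] is kept apart from [2 * n + 1] to allow induction on [n]. The path label cancels [j] in
    row [p = 0]; each further pair of values of [p] has opposite reading directions and row numbers
    summing to [2 * m + 2 - 2 * b]. *)
Lemma sum_lab_row N m n b j : j < N -> 2 * n + 1 <= m ->
  j.+1 + \sum_(p < 2 * n + 1) lab N m b p j =
  ((m + 2 - b) * N + n * ((2 * m + 3 - 2 * b) * N + 1)).+1.
Proof.
move=> jN; elim: n => [|n IHn] nm.
  by rewrite big_ord_recl big_ord0 /lab /row /pos /=; case: b => /=; nia.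
have -> : 2 * n.+1 + 1 = (2 * n + 1).+2 by lia.
rewrite !big_ord_recr (mulSn n) /= !addnA IHn; last by lia.
have odd1 : odd (2 * n + 1) by lia.
rewrite /lab /row /pos /= odd1 /=.
(* Substituting for [m] and [N] removes the truncated subtractions. *)
have [d ->] : exists d, m = 2 * n + 3 + d by exists (m - (2 * n + 3)); lia.
have [k ->] : exists k, N = j + k.+1 by exists (N - j.+1); lia.
have -> : (j + k.+1).-1 - j = k by lia.
case: b {IHn nm} => /=.
  have -> : 2 * n + 3 + d + 2 - 1 = 2 * n + d + 4 by lia.
  have -> : 2 * (2 * n + 3 + d) + 3 - 2 * 1 = 4 * n + 2 * d + 7 by lia.
  have -> : 2 * n + 3 + d - (2 * n + 1).+1 = d.+1 by lia.
  lia.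
have -> : 2 * n + 3 + d - (2 * n + 1) = d.+2 by lia.
rewrite muln0 !subn0; lia.
Qed.

Lemma sum_pos_col r s i p : i < r ->
  \sum_(q < 2 * s) pos (2 * s * r) p (col r i q) = s * (2 * s * r).-1.
Proof.
move=> ir; rewrite /pos; case: (odd p); first exact: sum_col.
have := sum_col s ir.
(* Reversal sends each column [j] to [N.-1 - j], where [N = 2 * s * r]; the forward sum is exactly
   half of the total, so both sums agree. *)
suff : \sum_(q < 2 * s) ((2 * s * r).-1 - col r i q) + \sum_(q < 2 * s) col r i q
       = 2 * s * (2 * s * r).-1 by lia.
rewrite -big_split /= (eq_bigr (fun _ => (2 * s * r).-1)).
  by rewrite sum_nat_const card_ord.
by move=> q _; have := ltn_col ir (ltn_ord q); lia.
Qed.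

Lemma sum_lab_col r s m i p : i < r -> p < m ->
  \sum_(q < 2 * s) (lab (2 * s * r) m false p (col r i q) +
                    lab (2 * s * r) m true p (col r i q)) =
  2 * s * ((2 * m + 2) * (2 * s * r) + 1).
Proof.
move=> ir pm; case: s => [|s]; first by rewrite big_ord0.
set N := 2 * s.+1 * r.
(* For a given [p], the two rows are [m - p] and [m + p.+1], with sum [2 * m + 1], and both are read
   in the same direction. *)
rewrite (eq_bigr (fun q : 'I_(2 * s.+1) =>
   (2 * m + 1) * N + 2 + 2 * pos N p (col r i q))).
  rewrite big_split /= -big_distrr /= sum_pos_col // sum_nat_const card_ord.
  have : 0 < N by rewrite /N; nia.
  by rewrite -/N; move: N => N; nia.
move=> q _; rewrite /lab /row.
have [d ->] : exists d, m = p + d by exists (m - p); lia.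
by case: odd => /=; nia.
Qed.

(** With [N] fixed, the right side increases with the factor [2 * s], and both left sides lie
    strictly between its values for the factors [n] and [n.+1]. *)
Lemma end_color_neq n r s (b : bool) : 0 < r -> 0 < s ->
  let m := 2 * n + 1 in let N := 2 * s * r in
  ((m + 2 - b) * N + n * ((2 * m + 3 - 2 * b) * N + 1)).+1 <>
  2 * s * ((2 * m + 2) * N + 1).
Proof.
move=> r0 s0 /=; case: b => /=.
- have [h|h] := leqP n.+1 (2 * s); last by nia.
  have : 0 < s * r by nia.
  by nia.
- by have [h|h] := leqP n.+1 (2 * s); nia.
Qed.

(** * The labeling of the graph and its three colours *)

Section Labeling.
Variables n r s : nat.
Let m := 2 * n + 1.
Let N := 2 * s * r.
Let G := copies r (join (copies (2 * s) (path_graph 2)) (edgeless m)).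

Definition weight (x y : G) : nat :=
  match x.2, y.2 with
  | inl a, inl _ => (col r x.1 a.1).+1
  | inl a, inr p => lab N m (a.2 != ord0) p (col r x.1 a.1)
  | inr p, inl a => lab N m (a.2 != ord0) p (col r x.1 a.1)
  | inr _, inr _ => 0
  end.

Lemma weight_sym (x y : G) : adj x y -> weight x y = weight y x.
Proof.
case: x y => [i [[q a]|p]] [j [[q' a']|p']] //= /andP [/= /eqP -> //].
by rewrite /weight => /andP [/= /eqP ->].
Qed.

Definition labeling : {set G} -> nat := edge_fun weight.

(** [None] stands for the edge of the path, [Some (p, b)] for the edge joining end [b] to vertex [p]
    of [O_m]; this gives [2 * m + 1] rows of [N] edges. *)
Definition edge_code : finType := ('I_r * 'I_(2 * s) * option ('I_m * bool))%type.

Definition edge_end (i : 'I_r) (q : 'I_(2 * s)) (b : bool) : G :=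
  (i, inl (q, if b then ord_max else ord0)).

Definition edge_apex (i : 'I_r) (p : 'I_m) : G := (i, inr p).

Definition edge_of (c : edge_code) : {set G} :=
  let: (i, q, o) := c in
  if o is Some (p, b) then [set edge_end i q b; edge_apex i p]
  else [set edge_end i q false; edge_end i q true].

Definition code_row (c : edge_code) : nat :=
  if c.2 is Some (p, b) then row m b p else 0.

Definition code_pos (c : edge_code) : nat :=
  let j := col r c.1.1 c.1.2 in
  if c.2 is Some (p, b) then pos N p j else j.

Lemma labeling_edge_of c : labeling (edge_of c) = (code_row c * N + code_pos c).+1.
Proof.
case: c => [[i q] [[p b]|]] /=; rewrite /labeling edge_funE //;
  try exact: weight_sym; rewrite /= /copies_adj /= ?eqxx //.
- by rewrite /weight /lab /code_row /code_pos /=; case: b.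
- by rewrite /copies_adj /= eqxx.
Qed.

Lemma ltn_code_pos c : code_pos c < N.
Proof.
case: c => [[i q] [[p b]|]]; rewrite /code_pos /=; last exact: ltn_col.
by apply: ltn_pos; apply: ltn_col.
Qed.

(** Row and position are the quotient and remainder modulo [N] of the label minus 1; the row, then
    the position, recovers the code. *)
Lemma labeling_edge_of_inj : injective (labeling \o edge_of).
Proof.
move=> c c' /=; rewrite !labeling_edge_of => /succn_inj /divmod_inj.
case/(_ (ltn_code_pos c) (ltn_code_pos c')).
have om : odd m by rewrite /m; lia.
have cN := ltn_col (ltn_ord _) (ltn_ord _).
have eq_col (i i' : 'I_r) (q q' : 'I_(2 * s)) :
    col r i q = col r i' q' -> (i, q) = (i', q').
  by move=> /(col_inj (ltn_ord i) (ltn_ord i')) [/val_inj -> /val_inj ->].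
case: c c' => [[i q] [[p b]|]] [[i' q'] [[p' b']|]];
  rewrite /code_row /code_pos /=.
- move=> /row_inj [] // -> /val_inj -> /pos_inj.
  by move=> /(_ (cN _ _ _ _)) /(_ (cN _ _ _ _)) /eq_col [-> ->].
- by move=> rp; have := row_gt0 b (ltn_ord p); rewrite rp.
- by move=> rp; have := row_gt0 b' (ltn_ord p'); rewrite -rp.
- by move=> _ /eq_col [-> ->].
Qed.

Lemma edges_edge_of : edges G = [set edge_of c | c : edge_code].
Proof.
have end_eq i q (a : 'I_2) : (i, inl (q, a)) = edge_end i q (a != ord0) :> G.
  rewrite /edge_end; case: eqVneq => [-> //|a0] /=; congr (_, inl (_, _)).
  by apply: val_inj; case: a a0 => [[|[|]]].
apply/setP => e; apply/edgesP/imsetP; last first.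
  move=> [[[i q] [[p b]|]] _ ->] /=.
    by exists (edge_end i q b), (edge_apex i p); rewrite /= /copies_adj /= eqxx.
  exists (edge_end i q false), (edge_end i q true).
  by rewrite /= /copies_adj /= /copies_adj /= !eqxx.
case=> [[i [[q a]|p]] [[i' [[q' a']|p']] [/andP [/= /eqP <- ad] ->]]] //.
- move: ad; rewrite /= /copies_adj /= => /andP [/eqP <- aa].
  exists (i, q, None) => //=; rewrite !end_eq.
  by rewrite (path2_adj_neq0 aa); case: eqP; rewrite //= setUC.
- by exists (i, q, Some (p', a != ord0)) => //=; rewrite end_eq.
- by exists (i, q', Some (p, a' != ord0)) => //=; rewrite end_eq setUC.
Qed.

Lemma labeling_bijection : edge_bijection labeling.
Proof.
apply: (edge_bijection_param edges_edge_of labeling_edge_of_inj) => c.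
rewrite labeling_edge_of /edge_code !card_prod card_option card_prod !card_ord card_bool.
have := ltn_code_pos c.
have : code_row c <= 2 * m.
  by case: c => [[i q] [[p b]|]]; rewrite /code_row /= ?row_le.
by rewrite /N; nia.
Qed.

Definition end_color (b : bool) : nat :=
  ((m + 2 - b) * N + n * ((2 * m + 3 - 2 * b) * N + 1)).+1.

Definition apex_color : nat := 2 * s * ((2 * m + 2) * N + 1).

Lemma ltn_end_color : 0 < r -> 0 < s -> end_color true < end_color false.
Proof.
move=> r0 s0; have : 0 < N by rewrite /N; nia.
rewrite /end_color /m; move: N => k k0.
have -> : 2 * n + 1 + 2 - true = 2 * n + 2 by lia.
have -> : 2 * n + 1 + 2 - false = 2 * n + 3 by lia.
have -> : 2 * (2 * n + 1) + 3 - 2 * true = 4 * n + 3 by lia.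
have -> : 2 * (2 * n + 1) + 3 - 2 * false = 4 * n + 5 by lia.
by nia.
Qed.

Lemma vlabel_labelingE (x : G) : vlabel labeling x = \sum_(y | adj x y) weight x y.
Proof.
by rewrite vlabelE; apply: eq_bigr => y xy; rewrite /labeling edge_funE //; exact: weight_sym.
Qed.

Lemma vlabel_end i q (a : 'I_2) :
  vlabel labeling ((i, inl (q, a)) : G) = end_color (a != ord0).
Proof.
rewrite vlabel_labelingE sum_adj_copies sum_adj_joinl sum_adj_copies /weight /=.
rewrite sum_nat_const.
(* An end has one neighbour on its path, so the path label enters once, as the leading [j.+1] of
   [sum_lab_row]. *)
have -> : #|[pred y | path_adj a y]| = 1.
  rewrite -sum1_card.
  by case: a => [[|[|]] ?] //=; rewrite big_mkcond !big_ord_recr big_ord0.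
rewrite mul1n /end_color -(@sum_lab_row N m n _ (col r i q)) //.
exact: ltn_col.
Qed.

Lemma vlabel_apex i (p : 'I_m) : vlabel labeling ((i, inr p) : G) = apex_color.
Proof.
rewrite vlabel_labelingE sum_adj_copies sum_adj_joinr /weight /=.
rewrite [X in _ + X]big_pred0 // addn0.
(* Regrouping by paths brings together the two edges from each path to [p]. *)
rewrite -(pair_big predT predT (fun (q : 'I_(2 * s)) (a : 'I_2) => lab N m (a != ord0) p (col r i q))) /=.
rewrite /apex_color -(@sum_lab_col r s m i p) //.
by apply: eq_bigr => q _; rewrite !big_ord_recr big_ord0.
Qed.

Lemma labeling_local_antimagic : 0 < r -> 0 < s -> local_antimagic labeling.
Proof.
move=> r0 s0; split; first exact: labeling_bijection.
have ea b : end_color b <> apex_color by exact: end_color_neq.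
case=> [i [[q a]|p]] [i' [[q' a']|p']] /andP [/= _] //; rewrite ?vlabel_end ?vlabel_apex.
- move=> /andP [_ /path2_adj_neq0 ->].
  by have := ltn_end_color r0 s0; case: eqP => _ /=; lia.
- by move=> _; apply: ea.
- by move=> _ /esym; apply: ea.
Qed.

Lemma num_colors_labeling : num_colors labeling <= 3.
Proof.
apply: (@num_colors_le _ _ [:: end_color false; end_color true; apex_color]).
case=> [i [[q a]|p]]; rewrite ?vlabel_end ?vlabel_apex !inE ?eqxx ?orbT //.
by case: (a != ord0); rewrite eqxx ?orbT.
Qed.

Lemma num_colors_ge3 (f : {set G} -> nat) : 0 < r -> 0 < s ->
  local_antimagic f -> 3 <= num_colors f.
Proof.
move=> r0 s0 f_la.
have s0' : 0 < 2 * s by lia.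
have m0 : 0 < m by rewrite /m; lia.
pose i := Ordinal r0; pose q := Ordinal s0'.
apply: (@triangle_num_colors _ _ (edge_end i q false) (edge_end i q true)
          (edge_apex i (Ordinal m0)) f_la);
  by rewrite /= /copies_adj /= ?/copies_adj /= ?eqxx.
Qed.

End Labeling.

Theorem theorem3p3 (n r s : nat) (hn : 1 <= n) (hr : 2 <= r) (hs : 1 <= s) :
  chi_la_eq
    (copies r (join (copies (2 * s) (path_graph 2)) (edgeless (2 * n + 1)))) 3.
Proof.
have r0 : 0 < r by lia.
split; last by move=> f; apply: num_colors_ge3.
have la := labeling_local_antimagic n r0 hs.
exists (@labeling n r s) => //.
by apply/eqP; rewrite eqn_leq num_colors_labeling num_colors_ge3.
Qed.
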